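(* Let $a,b\in\mathbb{R}$ with $b-a$ a positive integer, let $\alpha$ satisfy $0<\alpha(t)<1/2$ for all $t\in\mathbb{N}_{a+1,b-1}$, and let $L:\mathbb{N}_{a+1,b-1}\times\mathbb{R}\times\mathbb{R}\to\mathbb{R}$, $(t,x,y)\mapsto L(t,x,y)$, be such that $L(t,\cdot,\cdot)$ is differentiable for each $t$. For $f:\mathbb{N}_{a,b-1}\to\mathbb{R}$ put $$J(f)=\sum_{t=a+1}^{b-1}L\bigl(t,f^{\rho}(t),{}^{ABC}_{a}\nabla^{\alpha(t)}f(t)\bigr).$$ Let $f:\mathbb{N}_{a,b-1}\to\mathbb{R}$ be a local extremum of $J$ satisfying the boundary conditions $f(a)=A_0$, $f(b-1)=B_0$, where $A_0,B_0\in\mathbb{R}$ are given. Then $f$ satisfies the Euler--Lagrange equation $$L_1^{\sigma}(t)+{}^{ABR}\widehat{\nabla}_b^{\alpha(t)}L_2(t)=0,\qquad t\in\mathbb{N}_{a+1,b-2},$$ where $L_1(t)=\frac{\partial L}{\partial x}\bigl(t,f^{\rho}(t),{}^{ABC}_{a}\nabla^{\alpha(t)}f(t)\bigr)$ and $L_2(t)=\frac{\partial L}{\partial y}\bigl(t,f^{\rho}(t),{}^{ABC}_{a}\nabla^{\alpha(t)}f(t)\bigr)$ are the partial derivatives of $L$ with respect to its second and third arguments, evaluated along $f$.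
   Context: $\mathbb{N}_{p,q}=\{p,p+1,\dots,q\}$ (empty if $q<p$). Sums $\sum_{t=p}^{q}$ run over $t=p,p+1,\dots,q$ (empty sums are $0$). $\rho(t)=t-1$, $\sigma(t)=t+1$, $f^\rho(t)=f(t-1)$, $L_1^\sigma(t)=L_1(t+1)$; $\nabla f(t)=f(t)-f(t-1)$; $\Delta f(t)=f(t+1)-f(t)$. ''Local extremum of $J$ satisfying the boundary conditions'' means that $f$ satisfies the boundary conditions and is a local minimizer or local maximizer of $J$ among functions on the finite set $\mathbb{N}_{a,b-1}$ satisfying the same boundary conditions. $\Gamma$ is the Gamma function, and the rising function is $t^{\overline{\beta}}=\Gamma(t+\beta)/\Gamma(t)$ for real $\beta$ and $t\in\mathbb{R}\setminus\{\dots,-2,-1,0\}$, with $0^{\overline{\beta}}=0$. For $|\lambda|<1$ and $\beta>0$, the nabla discrete Mittag--Leffler function is $$E_{\overline{\beta}}[\lambda,z]=\sum_{k=0}^\infty\lambda^k\frac{z^{\overline{k\beta}}}{\Gamma(\beta k+1)}.$$ $B(\cdot):[0,1]\to(0,\infty)$ is a normalization function with $B(0)=B(1)=1$ (unrelated to the boundary value $B_0$). The type I left Caputo $AB$ nabla fractional difference of order $\alpha(t)$ is, for $t\in\mathbb{N}_{a+1,b-1}$, $${}^{ABC}_{a}\nabla^{\alpha(t)}f(t)=\frac{B(\alpha(t))}{1-\alpha(t)}\sum_{s=a+1}^tE_{\overline{\alpha(t)}}\left[\frac{-\alpha(t)}{1-\alpha(t)},t-\rho(s)\right]\nabla f(s).$$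 The type II discrete right generalized fractional integral operator is $$\mathcal{E}_{\overline{\alpha(t),1},\frac{-\alpha(t)}{1-\alpha(t)},b^-}\varphi(t)=\sum_{s=t}^{b-1}\frac{B(\alpha(s))}{1-\alpha(s)}E_{\overline{\alpha(s)}}\left[\frac{-\alpha(s)}{1-\alpha(s)},s-\rho(t)\right]\varphi(s),$$ and the type II right Riemann--Liouville $AB$ nabla fractional difference of order $\alpha(t)$ is $${}^{ABR}\widehat{\nabla}_b^{\alpha(t)}\varphi(t)=-\Delta\,\mathcal{E}_{\overline{\alpha(t),1},\frac{-\alpha(t)}{1-\alpha(t)},b^-}\varphi(t),$$ where $\Delta$ acts on the whole function $t\mapsto\mathcal{E}_{\dots}\varphi(t)$. *)

(* Defs.v *)
From HB Require Import structures.
From mathcomp Require Import all_boot all_order all_algebra.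
From mathcomp Require Import all_classical all_reals all_analysis.

Set Implicit Arguments.
Unset Strict Implicit.
Unset Printing Implicit Defensive.

Import Order.TTheory GRing.Theory Num.Theory.
Import numFieldNormedType.Exports.

Local Open Scope classical_set_scope.
Local Open Scope ring_scope.

(* Functions on a set {p, p+1, ..., q} of real points are represented by total
   functions R -> R of which only the values on that set are used. *)

(* {p, p+1, ..., q}; empty if q < p. *)
Definition dint {R : realType} (p q : R) : set R :=
  [set t | exists k : nat, t = p + k%:R /\ t <= q].

(* Since dint p q is finite, the finitely supported sum over it is the ordinary
   sum over t = p, p+1, ..., q. *)
Definition dsum {R : realType} (p q : R) (F : R -> R) : R :=
  \sum_(t \in dint p q) F t.

Definition rho {R : realType} (t : R) : R := t - 1.
Definition sigma {R : realType} (t : R) : R := t + 1.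
Definition nabla {R : realType} (f : R -> R) (t : R) : R := f t - f (t - 1).
Definition fwd_diff {R : realType} (f : R -> R) (t : R) : R := f (t + 1) - f t.

Definition euler_integral {R : realType} (x : R) : R :=
  (\int[lebesgue_measure]_(u in `]0%R, +oo[) (u `^ (x - 1) * expR (- u))%R)%R.

(* Gamma on R: Euler's integral for x > 0; for x <= 0 the extension by
   Gamma x = Gamma (x + n) / (x (x + 1) ... (x + n - 1)) with n > - x.
   At the poles 0, -1, -2, ... the denominator vanishes and the value is 0. *)
Definition Gamma {R : realType} (x : R) : R :=
  if 0 < x then euler_integral x
  else let n := (Num.truncn (- x)).+1 in
       euler_integral (x + n%:R) / \prod_(i < n) (x + i%:R).

(* t^{\overline{beta}} *)
Definition rising {R : realType} (t beta : R) : R :=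
  if t == 0 then 0 else Gamma (t + beta) / Gamma t.

(* E_{\overline{beta}}[lambda, z], meaningful for `|lambda| < 1, beta > 0. *)
Definition nabla_ML {R : realType} (beta lambda z : R) : R :=
  limn (fun n : nat => \sum_(0 <= k < n)
    lambda ^+ k * (rising z (k%:R * beta) / Gamma (beta * k%:R + 1))).

(* Type I left Caputo AB nabla fractional difference of order alpha(t). *)
Definition ABC_left {R : realType} (B alpha : R -> R) (a : R)
    (f : R -> R) (t : R) : R :=
  B (alpha t) / (1 - alpha t) *
  dsum (a + 1) t (fun s =>
    nabla_ML (alpha t) (- alpha t / (1 - alpha t)) (t - rho s) * nabla f s).

(* Type II discrete right generalized fractional integral operator. *)
Definition genint_right {R : realType} (B alpha : R -> R) (b : R)
    (phi : R -> R) (t : R) : R :=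
  dsum t (b - 1) (fun s =>
    B (alpha s) / (1 - alpha s) *
    nabla_ML (alpha s) (- alpha s / (1 - alpha s)) (s - rho t) * phi s).

(* Type II right Riemann-Liouville AB nabla fractional difference. *)
Definition ABR_right {R : realType} (B alpha : R -> R) (b : R)
    (phi : R -> R) (t : R) : R :=
  - fwd_diff (genint_right B alpha b phi) t.

Definition functional_J {R : realType} (B alpha : R -> R) (a b : R)
    (L : R -> R -> R -> R) (f : R -> R) : R :=
  dsum (a + 1) (b - 1) (fun t => L t (f (rho t)) (ABC_left B alpha a f t)).

Definition L1_along {R : realType} (B alpha : R -> R) (a : R)
    (L : R -> R -> R -> R) (f : R -> R) (t : R) : R :=
  derive1 (fun x : R => L t x (ABC_left B alpha a f t)) (f (rho t)).

Definition L2_along {R : realType} (B alpha : R -> R) (a : R)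
    (L : R -> R -> R -> R) (f : R -> R) (t : R) : R :=
  derive1 (fun y : R => L t (f (rho t)) y) (ABC_left B alpha a f t).

Definition boundary {R : realType} (a b A0 B0 : R) (f : R -> R) : Prop :=
  f a = A0 /\ f (b - 1) = B0.

(* "Local" refers to the sup-norm on the finite set {a, ..., b-1}. *)
Definition sup_close {R : realType} (a b d : R) (f g : R -> R) : Prop :=
  forall t, dint a (b - 1) t -> `|g t - f t| < d.

Definition local_extremum {R : realType} (a b A0 B0 : R)
    (J : (R -> R) -> R) (f : R -> R) : Prop :=
  boundary a b A0 B0 f /\
  ((exists d : R, 0 < d /\ forall g : R -> R,
      boundary a b A0 B0 g -> sup_close a b d f g -> J f <= J g) \/
   (exists d : R, 0 < d /\ forall g : R -> R,
      boundary a b A0 B0 g -> sup_close a b d f g -> J g <= J f)).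

(* Main.v *)
Require Import Defs.
From HB Require Import structures.
From mathcomp Require Import all_boot all_order all_algebra.
From mathcomp Require Import all_classical all_reals all_analysis.
From mathcomp Require Import lra.
Import Order.TTheory GRing.Theory Num.Theory.
Import numFieldNormedType.Exports.
Local Open Scope classical_set_scope.
Local Open Scope ring_scope.

(* For an interior point t let h be the indicator of t. The functions f + e h
   satisfy the boundary conditions, so e |-> J (f + e h) has a local extremum,
   hence a vanishing derivative, at e = 0. The difference operator is linear
   and nabla h is 1 at t, -1 at t + 1 and 0 elsewhere, so this derivative is
   L_1 (t + 1) plus the sum over u of L_2 u times the difference of the kernel
   at (u, t) and (u, t + 1), where each kernel term occurs only if its second
   argument is <= u. These are the two values of the right integral operator
   in its forward difference. *)

Lemma finite_dint (R : realType) (p q : R) : finite_set (dint p q).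
Proof.
apply: (@sub_finite_set _ _ [set p + k%:R | k in `I_(Num.truncn (q - p)).+1]).
  move=> _ [k [-> kq]]; exists k => //=; rewrite ltnS.
  rewrite truncn_ge_nat; last by have := ler0n R k; lra.
  by lra.
exact/finite_image/finite_II.
Qed.

Lemma dintD1 (R : realType) (p q t : R) : dint p (q - 1) t -> dint p q (t + 1).
Proof.
move=> [k [-> kq]]; exists k.+1; split; first by rewrite -natr1 addrA.
by lra.
Qed.

Lemma dint_ge (R : realType) (p q t : R) : dint p q t -> p <= t.
Proof. by move=> [k [-> _]]; rewrite lerDl. Qed.

(** With [t = p + k%:R], both sides consist of the points [p + j%:R] up to [q] with [k <= j]. The
    hypothesis places [t] on the grid of [p]; the bound [r] is free. *)
Lemma dint_suffix (R : realType) (p q r t : R) : dint p r t ->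
  dint t q = dint p q `&` [set u | dint p u t].
Proof.
move=> [k [-> _]]; apply/seteqP; split=> u /=.
  move=> [j [-> jq]]; split; first by exists (k + j)%N; rewrite natrD addrA.
  by exists k; split=> //; rewrite lerDl.
move=> [[j [-> jq]] [_ [_]]]; rewrite lerD2l ler_nat => kj.
by exists (j - k)%N; split=> //; rewrite natrB//; lra.
Qed.

Lemma dsum_delta (R : realType) (p q c : R) (F : R -> R) :
  dsum p q (fun s => F s * (s == c)%:R) = if c \in dint p q then F c else 0.
Proof.
rewrite /dsum; case: ifPn => [/set_mem cpq|/negP cpq].
  rewrite (fsbigD1 c)//=; last exact: finite_dint.
  rewrite eqxx mulr1 fsbig1 ?addr0// => s [_ /eqP/negbTE ->].
  by rewrite mulr0.
apply: fsbig1 => s spq; case: eqP => [sc|_]; last by rewrite mulr0.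
by exfalso; apply: cpq; rewrite inE -sc.
Qed.

Lemma eq_dsum (R : realType) (p q : R) (F G : R -> R) :
  (forall s, dint p q s -> F s = G s) -> dsum p q F = dsum p q G.
Proof. by move=> FG; apply: eq_fsbigr => s /set_mem/FG. Qed.

Lemma dsumD (R : realType) (p q : R) (F G : R -> R) :
  dsum p q (fun s => F s + G s) = dsum p q F + dsum p q G.
Proof. by rewrite /dsum fsbig_split//; exact: finite_dint. Qed.

Lemma dsumZ (R : realType) (p q c : R) (F : R -> R) :
  dsum p q (fun s => c * F s) = c * dsum p q F.
Proof. by rewrite /dsum mulr_fsumr. Qed.

Lemma dsumB (R : realType) (p q : R) (F G : R -> R) :
  dsum p q (fun s => F s - G s) = dsum p q F - dsum p q G.
Proof.
rewrite -mulN1r -dsumZ -dsumD; apply: eq_dsum => s _.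
by rewrite mulN1r.
Qed.

(** Exchange of summation order: for [u] on the grid, [t] is in the inner range up to [u] exactly
    when [u] is in the outer range from [t]. *)
Lemma dsum_suffix (R : realType) (p q r t : R) (F : R -> R) : dint p r t ->
  dsum p q (fun u => if t \in dint p u then F u else 0) = dsum t q F.
Proof.
move=> /dint_suffix tpr; rewrite /dsum tpr fsbig_mkcondr.
by apply: eq_fsbigr => u _; congr (if _ then _ else _).
Qed.

Lemma is_derive_dsum (R : realType) (p q e : R) (G : R -> R -> R) (dG : R -> R) :
  (forall u, dint p q u -> is_derive e 1 (G u) (dG u)) ->
  is_derive e 1 (fun x => dsum p q (fun u => G u x)) (dsum p q dG).
Proof.
move=> GdG; rewrite /dsum.
have fin := finite_dint _ p q.
under eq_fun do rewrite (fsbig_finite _ _ fin).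
rewrite (fsbig_finite _ _ fin).
have : forall u, u \in finmap.enum_fset (fset_set (dint p q)) -> dint p q u.
  by move=> u; rewrite in_fset_set ?inE.
elim: (finmap.enum_fset _) => [_|u s IH sub].
  by under eq_fun do rewrite big_nil; rewrite big_nil; exact: is_derive_cst.
under eq_fun do rewrite big_cons.
rewrite big_cons; apply: is_deriveD.
  by apply/GdG/sub; rewrite mem_head.
by apply: IH => v vs; apply: sub; rewrite in_cons vs orbT.
Qed.

(** The difference quotient of [F] restricted to the line is the one defining the derivative of [F]
    at [p + e *: v] along [v]. *)
Lemma is_derive_line (R : realType) (V W : normedModType R) (F : V -> W)
    (p v : V) (e : R) : differentiable F (p + e *: v) ->
  is_derive e 1 (fun x : R => F (p + x *: v)) ('d F (p + e *: v) v).
Proof.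
move=> dF.
have E : (fun h : R => h^-1 *: (((fun x : R => F (p + x *: v)) \o shift e) (h *: 1)
            - F (p + e *: v)))
       = (fun h : R => h^-1 *: ((F \o shift (p + e *: v)) (h *: v)
            - F (p + e *: v))).
  apply/funext => h /=; congr (_ *: (F _ - _)).
  by rewrite [h *: 1]mulr1 scalerDl addrCA.
split; first by rewrite /derivable E; exact: diff_derivable.
by rewrite -(deriveE v dF) /derive E.
Qed.

Lemma derive1_fst (R : realType) (F : R -> R -> R) (x y : R) :
  differentiable (fun q : R * R => F q.1 q.2) (x, y) ->
  derive1 (fun z => F z y) x = 'd (fun q : R * R => F q.1 q.2) (x, y) (1, 0).
Proof.
move=> dF; rewrite derive1E.
(* The line starts at [(0, y)], not at [(x, y)], so that its parameter is the first coordinate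
   itself. *)
have E : (fun z => F z y) = (fun z => (fun q : R * R => F q.1 q.2)
    ((0, y) + z *: (1, 0))).
  by apply/funext => z /=; rewrite !scaler0 add0r addr0 [z *: _]mulr1.
have xyE : (x, y) = (0, y) + x *: (1, 0) :> R * R.
  by congr pair => /=; rewrite ?scaler0 ?add0r ?addr0 // [x *: _]mulr1.
rewrite E; rewrite {}xyE in dF *.
by have [_ ->] := is_derive_line _ _ _ _ _ _ _ dF.
Qed.

Lemma derive1_snd (R : realType) (F : R -> R -> R) (x y : R) :
  differentiable (fun q : R * R => F q.1 q.2) (x, y) ->
  derive1 (F x) y = 'd (fun q : R * R => F q.1 q.2) (x, y) (0, 1).
Proof.
move=> dF; rewrite derive1E.
have E : F x = (fun z => (fun q : R * R => F q.1 q.2) ((x, 0) + z *: (0, 1))).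
  by apply/funext => z /=; rewrite !scaler0 add0r addr0 [z *: _]mulr1.
have xyE : (x, y) = (x, 0) + y *: (0, 1) :> R * R.
  by congr pair => /=; rewrite ?scaler0 ?add0r ?addr0 // [y *: _]mulr1.
rewrite E; rewrite {}xyE in dF *.
by have [_ ->] := is_derive_line _ _ _ _ _ _ _ dF.
Qed.

(** The derivative along the line is the differential at [(h, k)], which linearity splits into the
    two partial derivatives. *)
Lemma is_derive_partials (R : realType) (F : R -> R -> R) (x y h k : R) :
  differentiable (fun q : R * R => F q.1 q.2) (x, y) ->
  is_derive (0 : R) 1 (fun e => F (x + e * h) (y + e * k))
    (h * derive1 (fun z => F z y) x + k * derive1 (F x) y).
Proof.
move=> dF; rewrite derive1_fst// derive1_snd//.
have -> : h * 'd (fun q : R * R => F q.1 q.2) (x, y) (1, 0) +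
          k * 'd (fun q : R * R => F q.1 q.2) (x, y) (0, 1) =
          'd (fun q : R * R => F q.1 q.2) (x, y) (h, k).
  rewrite -[h * _]/(h *: _) -[k * _]/(k *: _) -!linearZ -linearD.
  by congr ('d _ _ _); congr pair => /=;
    rewrite scaler0 ?add0r ?addr0 [_ *: _]mulr1.
have xyE : (x, y) = (x, y) + 0 *: (h, k) :> R * R by rewrite scale0r addr0.
rewrite [in 'd _ _]xyE; apply: is_derive_line.
by rewrite -xyE.
Qed.

(** One kernel for both operators: the left difference sums it over [s], the right integral over
    [u]. In both, the order is taken at [u]. *)
Definition AB_kernel {R : realType} (B alpha : R -> R) (u s : R) : R :=
  B (alpha u) / (1 - alpha u) *
  nabla_ML (alpha u) (- alpha u / (1 - alpha u)) (u - rho s).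

Lemma ABC_leftE (R : realType) (B alpha : R -> R) (a : R) (f : R -> R) (u : R) :
  ABC_left B alpha a f u =
  dsum (a + 1) u (fun s => AB_kernel B alpha u s * nabla f s).
Proof. by rewrite /ABC_left -dsumZ; apply: eq_dsum => s _; rewrite mulrA. Qed.

Lemma ABC_leftD (R : realType) (B alpha : R -> R) (a e : R) (f h : R -> R) (u : R) :
  ABC_left B alpha a (fun s => f s + e * h s) u =
  ABC_left B alpha a f u + e * ABC_left B alpha a h u.
Proof.
rewrite !ABC_leftE -dsumZ -dsumD; apply: eq_dsum => s _.
by rewrite /nabla opprD addrACA -mulrBr mulrDr [in RHS]mulrCA.
Qed.

Lemma ABC_left_delta (R : realType) (B alpha : R -> R) (a t u : R) :
  ABC_left B alpha a (fun s => (s == t)%:R) u =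
  (if t \in dint (a + 1) u then AB_kernel B alpha u t else 0) -
  (if t + 1 \in dint (a + 1) u then AB_kernel B alpha u (t + 1) else 0).
Proof.
rewrite ABC_leftE -!dsum_delta -dsumB; apply: eq_dsum => s _.
by rewrite /nabla subr_eq mulrBr.
Qed.

(** Stated for any [f], extremal or not, because it is also applied at the perturbed functions. *)
Lemma functional_J_variation (R : realType) (B alpha : R -> R) (a b t : R)
    (L : R -> R -> R -> R) (f : R -> R) :
  (forall u : R, dint (a + 1) (b - 1) u -> forall p : R * R,
     differentiable (fun q : R * R => L u q.1 q.2) p) ->
  dint (a + 1) (b - 2) t ->
  is_derive (0 : R) 1
    (fun e => functional_J B alpha a b L (fun s => f s + e * (s == t)%:R))
    (L1_along B alpha a L f (sigma t)
      + ABR_right B alpha b (L2_along B alpha a L f) t).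
Proof.
move=> dL tab.
(* Since [t <= b - 2], the point [t + 1] is still in the range of the functional. It carries the
   [L1] term and starts the second right integral. *)
have t1ab : dint (a + 1) (b - 1) (t + 1) by apply: dintD1; congr dint: tab; lra.
set h := fun s => (s == t)%:R : R.
have -> : (fun e => functional_J B alpha a b L (fun s => f s + e * (s == t)%:R))
  = (fun e => dsum (a + 1) (b - 1) (fun u => L u (f (rho u) + e * h (rho u))
       (ABC_left B alpha a f u + e * ABC_left B alpha a h u))).
  by apply/funext => e; apply: eq_dsum => u _; rewrite ABC_leftD.
apply: is_derive_eq.
  by apply: is_derive_dsum => u /dL dLu; exact: is_derive_partials.
rewrite dsumD; congr (_ + _).
  (* The shift by [rho] moves the support of the variation from [t] to [t + 1]. *)
  transitivity (dsum (a + 1) (b - 1)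
      (fun u => L1_along B alpha a L f u * (u == t + 1)%:R)).
    by apply: eq_dsum => u _; rewrite /h /rho subr_eq mulrC.
  by rewrite dsum_delta mem_set.
rewrite /ABR_right /fwd_diff opprB.
have genE s : genint_right B alpha b (L2_along B alpha a L f) s =
    dsum s (b - 1) (fun u => AB_kernel B alpha u s * L2_along B alpha a L f u) by [].
(* The sums from [t] and from [t + 1] are extended by zero to the full range, so that the claim can
   be checked term by term. *)
rewrite !genE -(dsum_suffix _ _ _ _ _ _ tab) -(dsum_suffix _ _ _ _ _ _ t1ab) -dsumB.
apply: eq_dsum => u _; rewrite ABC_left_delta mulrBl.
by congr (_ - _); case: ifP => _; rewrite ?mul0r.
Qed.

(** Fermat's rule on []-d, d[]; the results it rests on ask for derivability on the whole interval,
    not only at 0. *)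
Lemma derive_at_local_extremum (R : realType) (phi : R -> R) (d l : R) :
  0 < d -> (forall e, derivable phi e 1) -> is_derive (0 : R) 1 phi l ->
  (forall e, `|e| < d -> phi 0 <= phi e) \/
  (forall e, `|e| < d -> phi e <= phi 0) -> l = 0.
Proof.
move=> d0 dphi [_ <-] ext.
have dd : - d <= d by lra.
have d00 : 0 \in `]-d, d[ by rewrite in_itv /= oppr_lt0 d0.
have near e : e \in `]-d, d[ -> `|e| < d by rewrite in_itv /= ltr_norml.
case: ext => ext.
  by have [] := derive1_at_min dd (fun e _ => dphi e) d00 (fun e ed => ext e (near e ed)).
by have [] := derive1_at_max dd (fun e _ => dphi e) d00 (fun e ed => ext e (near e ed)).
Qed.

(** The first variation is computed at parameter 0 only; this transports derivability to any [e]. *)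
Lemma derivable_translate (R : realType) (phi : R -> R) (e : R) :
  derivable (fun x => phi (e + x)) 0 1 -> derivable phi e 1.
Proof.
rewrite /derivable.
have -> : (fun h : R => h^-1 *: (((fun x => phi (e + x)) \o shift 0) (h *: 1)
      - phi (e + 0))) =
    (fun h : R => h^-1 *: ((phi \o shift e) (h *: 1) - phi e)).
  by apply/funext => h /=; rewrite !addr0 [e + _]addrC.
by [].
Qed.

Theorem theorem3 (R : realType) (a b : R) (n : nat)
    (hn : (0 < n)%N) (hab : b - a = n%:R)
    (B : R -> R)
    (hBpos : forall x : R, 0 <= x <= 1 -> 0 < B x)
    (hB0 : B 0 = 1) (hB1 : B 1 = 1)
    (alpha : R -> R)
    (halpha : forall t : R, dint (a + 1) (b - 1) t -> 0 < alpha t < 1 / 2)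
    (L : R -> R -> R -> R)
    (hL : forall t : R, dint (a + 1) (b - 1) t -> forall p : R * R,
        differentiable (fun q : R * R => L t q.1 q.2) p)
    (A0 B0 : R) (f : R -> R)
    (hf : local_extremum a b A0 B0 (functional_J B alpha a b L) f) :
  forall t : R, dint (a + 1) (b - 2) t ->
    L1_along B alpha a L f (sigma t)
      + ABR_right B alpha b (L2_along B alpha a L f) t = 0.
Proof.
move=> t tab.
(* As [a + 1 <= t <= b - 2], the indicator of [t] vanishes at both end points. *)
have ta : t != a by rewrite gt_eqF//; have := dint_ge _ _ _ _ tab; lra.
have tb : t != b - 1 by rewrite lt_eqF//; case: tab => k []; lra.
pose g e (s : R) := f s + e * (s == t)%:R.
have g0 : g 0 = f by apply/funext => s; rewrite /g mul0r addr0.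
case: hf => -[fa fb] ext.
have bg e : boundary a b A0 B0 (g e).
  by rewrite /boundary /g ![_ == t]eq_sym (negbTE ta) (negbTE tb) !mulr0 !addr0.
(* The perturbation has size [|e|] at [t] and 0 elsewhere, so the radius [d] serves for the
   parameter too. *)
have gd e d : `|e| < d -> sup_close a b d f (g e).
  move=> ed s _; rewrite /g addrAC subrr add0r; apply: le_lt_trans ed.
  by case: (s == t); rewrite ?mulr1 // mulr0 normr0.
have dJ e : derivable (functional_J B alpha a b L \o g) e 1.
  (* Because [g (e + x)] is [g e] plus [x] times the indicator, the variation formula with base
     function [g e] applies. *)
  apply: derivable_translate.
  have [D _] := functional_J_variation _ B alpha _ _ _ _ (g e) hL tab.
  rewrite (_ : (fun x => _) = fun x =>
    functional_J B alpha a b L (fun s => g e s + x * (s == t)%:R))//.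
  apply/funext => x /=; apply: congr1.
  by apply/funext => s; rewrite /g mulrDl addrA.
have J0 := functional_J_variation _ B alpha _ _ _ _ f hL tab.
case: ext => -[d [d0 ext]];
  apply: (derive_at_local_extremum _ _ _ _ d0 dJ J0); [left|right] => e ed;
  rewrite /= g0; apply: ext => //; exact: gd.
Qed.
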